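(* Let $f,g\in\mathbb{Z}[X]$ be nonconstant relatively prime polynomials, let $\theta_{1},\dots,\theta_{n}$ and $\xi_{1},\dots,\xi_{m}$ be the complex roots (listed with multiplicity) of $f$ and $g$, respectively, where $n=\deg f$ and $m=\deg g$, and assume that $\theta_{1}\cdots\theta_{n}\xi_{1}\cdots\xi_{m}\neq 0$. If for some positive divisor $d$ of $Res(f,g)$ we have $$\min_{i,j}|\theta_{i}-\xi_{j}|>d^{1/\min(m,n)}\quad\text{or}\quad \min_{i,j}\left|\frac{1}{\theta_{i}}-\frac{1}{\xi_{j}}\right|>d^{1/\min(m,n)},$$ then each one of $f$ and $g$ is a product of at most $\Omega\left(\frac{Res(f,g)}{d}\right)$ irreducible factors over $\mathbb{Q}$ (counting multiplicities).
   Context: $Res(f,g)$ is the resultant of $f$ and $g$. For a nonzero integer $N$, $\Omega(N)$ denotes the total number of prime factors of $N$, counting multiplicities, with $\Omega(\pm1)=0$. *)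

(* Defs.v *)
From mathcomp Require Import all_boot all_order all_algebra.
From mathcomp Require Import complex.
From mathcomp Require Import reals constructive_ereal exp.
Set Implicit Arguments.
Unset Strict Implicit.
Unset Printing Implicit Defensive.
Import Order.TTheory GRing.Theory Num.Theory.
Local Open Scope ring_scope.
Local Open Scope complex_scope.

Definition Omega (N : int) : nat := (\sum_(p <- primes `|N|) logn p `|N|)%N.

Definition polyZQ (f : {poly int}) : {poly rat} := map_poly intr f.

Definition deg (f : {poly int}) : nat := (size f).-1.

Definition complex_roots (R : realType) (f : {poly int}) (s : seq R[i]) : Prop :=
  map_poly intr f = (lead_coef f)%:~R *: \prod_(z <- s) ('X - z%:P).

(* The neutral element +oo only matters when s or t is empty. *)
Definition min_dist (R : realType) (s t : seq R[i]) : \bar R :=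
  \big[Order.min/+oo%E]_(x <- s) \big[Order.min/+oo%E]_(y <- t)
    (ComplexField.Normc.normc (x - y))%:E.

Definition product_of_at_most_irreducibles (k : nat) (p : {poly rat}) : Prop :=
  exists s : seq {poly rat},
    [/\ (forall q, q \in s -> irreducible_poly q),
        p = \prod_(q <- s) q
      & (size s <= k)%N].

(* Main.v *)
From HB Require Import structures.
Require Import Defs.
From mathcomp Require Import all_boot all_order all_algebra.
From mathcomp Require Import all_field.
From mathcomp Require Import complex.
From mathcomp Require Import reals constructive_ereal exp.
Import Order.TTheory GRing.Theory Num.Theory.
Local Open Scope ring_scope.

(** Write f as a product of integer polynomials f_1 ... f_r that are irreducible
    over Q (Gauss's lemma). The resultant is multiplicative, so Res(f, g) is the
    product of the integers N_k = Res(f_k, g). Up to sign,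
    N_k = lc(f_k)^m lc(g)^(n_k) prod (theta - xi), over the roots theta of f_k
    and xi of g, where n_k = deg f_k. The leading coefficients are nonzero
    integers, so if all the differences exceed d^(1/min(m,n)) >= 1 in modulus
    then |N_k| > d^(m n_k / min(m,n)) >= d. If it is the differences of inverses
    that are large, the same bound follows from theta - xi = theta xi
    (1/xi - 1/theta), because lc(f_k)^m prod theta^m and lc(g)^(n_k) prod
    xi^(n_k) are, up to sign, powers of the nonzero integers f_k(0) and g(0)
    ([lt_norm_resultant]).

    It remains to see that integers N_1, ..., N_r of modulus > d > 0 whose
    product is a multiple of d satisfy r <= Omega(N_1 ... N_r / d): one can write
    d = d_1 ... d_r with d_k > 0 dividing N_k, and then |N_k / d_k| > 1, so
    that N_k / d_k has a prime factor ([size_le_bigomega]). The claim on g follows by symmetry, as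
    Res(g, f) = +- Res(f, g).

    Multiplicativity and the product formula both come from the identity
    Res(p, q) = lc(q)^(deg p) N(p), where N(p) is the determinant of
    multiplication by p on F[X]/(q) ([resultant_mulmod]). *)

(** * Multiplication by a polynomial modulo another one *)

Section MulMod.
Variables (F : fieldType) (n : nat) (q : {poly F}).

(** The quotient F[X]/(q) is represented by the row vectors of coefficients of
    the remainders. The dimension [n] is independent of [q], so that rescaling
    [q] does not change the type of the matrix. *)
Definition mulmod (p : {poly F}) (u : 'rV[F]_n) : 'rV[F]_n :=
  poly_rV ((rVpoly u * p) %% q).

Lemma mulmod_is_linear p : linear (mulmod p).
Proof.
by move=> a u v; rewrite /mulmod linearP mulrDl -scalerAl modpD modpZl linearP.
Qed.

HB.instance Definition _ p :=
  GRing.isLinear.Build F 'rV[F]_n 'rV[F]_n _ (mulmod p) (mulmod_is_linear p).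

Definition mulmod_mx p : 'M[F]_n := lin1_mx (mulmod p).

Hypothesis sz_q : size q = n.+1.

Lemma rVpoly_mulmod p u : rVpoly (mulmod p u) = (rVpoly u * p) %% q.
Proof.
by rewrite poly_rV_K // -ltnS -sz_q ltn_modp -size_poly_eq0 sz_q.
Qed.

Lemma mulmod_mxM p1 p2 : mulmod_mx (p1 * p2) = mulmod_mx p1 *m mulmod_mx p2.
Proof.
apply/row_matrixP => i; rewrite row_mul !rowE !mul_rV_lin1 /= {1 2}/mulmod.
by rewrite rVpoly_mulmod mulrA [_ %% q * p2]mulrC modp_mul mulrC.
Qed.

Lemma mulmod_mxB p1 p2 : mulmod_mx (p1 - p2) = mulmod_mx p1 - mulmod_mx p2.
Proof.
apply/row_matrixP => i; rewrite linearB /= !rowE !mul_rV_lin1 /= /mulmod.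
by rewrite mulrBr modpD modpN linearB.
Qed.

Lemma mulmod_mxC c : mulmod_mx c%:P = c%:M.
Proof.
apply/row_matrixP => i; rewrite !rowE !mul_rV_lin1 mul_mx_scalar /= /mulmod.
rewrite mulrC mul_polyC modpZl modp_small ?linearZ /= ?rVpolyK //.
by rewrite rVpoly_delta size_polyXn sz_q ltnS.
Qed.

End MulMod.
Arguments mulmod {F} n q p u.
Arguments mulmod_mx {F} n q p.

Lemma mulmod_mxZr (F : fieldType) n (q : {poly F}) b p :
  b != 0 -> mulmod_mx n (b *: q) p = mulmod_mx n q p.
Proof.
move=> b0; apply/row_matrixP => i.
by rewrite !rowE !mul_rV_lin1 /= /mulmod modpZr.
Qed.

Lemma mulmod_mxX (F : fieldType) (q : {poly F}) : q \is monic ->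
  mulmod_mx (size q).-1 q 'X = companionmx q.
Proof.
move=> mq; apply/row_matrixP => i; rewrite rowE mul_rV_lin1 /= /mulmod.
have q0 := monic_neq0 mq.
have sq : size q = (size q).-1.+1 by rewrite prednK ?size_poly_gt0.
have lt_q k : (k <= (size q).-1)%N -> (k < size q)%N by rewrite [in (_ < _)%N]sq.
rewrite rVpoly_delta -exprSr; apply/rowP => j; rewrite !mxE.
case: eqP => [i_last|i_small].
  have -> : 'X^(i.+1) = 1 * q + ('X^(i.+1) - q) by rewrite mul1r addrC subrK.
  have eq_n : i.+1 = (size q).-1 by rewrite i_last prednK // (leq_trans _ (ltn_ord i)).
  rewrite modp_addl_mul_small; last first.
    apply/lt_q/leq_sizeP => k.
    rewrite leq_eqVlt => /predU1P[<-|k_gt]; rewrite coefB coefXn eq_n.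
      by move/monicP: mq; rewrite lead_coefE eqxx => ->; rewrite subrr.
    by rewrite gtn_eqF // nth_default ?subrr //; rewrite -sq in k_gt.
  by rewrite coefB coefXn eq_n ltn_eqF ?sub0r.
rewrite modp_small ?coefXn 1?eq_sym //.
apply: lt_q; rewrite size_polyXn ltn_neqAle ltn_ord andbT.
by apply/eqP => e; apply: i_small; exact: (congr1 predn e).
Qed.

(** The matrix of multiplication by X is the companion matrix of [q], whose
    characteristic polynomial is [q]. *)
Lemma det_mulmod_XsubC (F : fieldType) n (q : {poly F}) x :
  size q = n.+1 -> q \is monic ->
  \det (mulmod_mx n q ('X - x%:P)) = (-1) ^+ n * q.[x].
Proof.
move=> sq mq; rewrite mulmod_mxB mulmod_mxC //.
have -> : n = (size q).-1 by rewrite sq.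
rewrite mulmod_mxX // -opprB -[- _]scaleN1r detZ; congr (_ * _).
rewrite -[in RHS](companionmxK mq) /char_poly -horner_evalE -det_map_mx.
by congr (\det _); apply/matrixP => i j; rewrite !mxE /= horner_evalE !hornerE hornerMn !hornerE.
Qed.

(** * Resultants *)

(** Dividing each row X^i p of the Sylvester matrix by q is a row operation that
    replaces it by X^i p mod q: in the basis formed by the X^i with i < deg q and
    by the X^j q, the Sylvester matrix is block triangular with diagonal blocks
    the multiplication matrix and the identity. The change of basis is itself
    triangular, with diagonal entries 1 and lc(q). *)
Lemma resultant_mulmod (F : fieldType) (p q : {poly F}) : p != 0 -> q != 0 ->
  resultant p q =
    lead_coef q ^+ (size p).-1 * \det (mulmod_mx (size q).-1 q p).
Proof.
move=> p0 q0; rewrite /resultant /Sylvester_mx.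
set n := (size p).-1; set m := (size q).-1.
have sp : size p = n.+1 by rewrite prednK ?size_poly_gt0.
have sq : size q = m.+1 by rewrite prednK ?size_poly_gt0.
pose low : 'M[F]_(m, m + n) := lin1_mx (poly_rV \o rVpoly).
pose band : 'M[F]_(n, m + n) := lin1_mx (poly_rV \o q \o* rVpoly).
pose Q : 'M[F]_(m, n) := \matrix_i poly_rV (('X^i * p) %/ q).
have -> : col_mx (lin1_mx (poly_rV \o p \o* rVpoly)) band =
   block_mx (mulmod_mx m q p) Q 0 1%:M *m col_mx low band.
  rewrite mul_block_col mul0mx mul1mx add0r; congr col_mx.
  apply/row_matrixP => i; rewrite linearD /= !row_mul rowK.
  rewrite !rowE !mul_rV_lin1 /= rVpoly_mulmod // rVpoly_delta.
  rewrite poly_rV_K; last first.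
    rewrite size_divp // leq_subLR.
    rewrite (leq_trans (size_polyMleq _ _)) // size_polyXn addSn /= sp addnS /= ltn_add2r.
    exact: ltn_ord.
  by rewrite {1}(divp_eq ('X^i * p) q) linearD addrC.
rewrite det_mulmx det_ublock det1 mulr1 mulrC; congr (_ * _).
(* What remains is the determinant of the change of basis. *)
rewrite det_trig.
  rewrite big_split_ord /= big1 ?mul1r => [|i _]; last first.
    by rewrite col_mxEu !mxE /= rVpoly_delta coefXn eqxx.
  rewrite (eq_bigr (fun=> lead_coef q)) => [|i _].
    by rewrite prodr_const card_ord.
  rewrite col_mxEd !mxE /= rVpoly_delta coefXnM /= ltnNge leq_addl /=.
  by rewrite addnK lead_coefE.
apply/is_trig_mxP => i j lt_ij; rewrite mxE.
case: splitP => k def_i; rewrite !mxE /= rVpoly_delta.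
  by rewrite coefXn -def_i gtn_eqF.
rewrite coefXnM; case: ifP => // /negbT; rewrite -leqNgt => le_kj.
by rewrite nth_default // sq ltn_subRL [(k + m)%N]addnC -def_i.
Qed.

Lemma resultantMl (F : fieldType) (p1 p2 q : {poly F}) :
  p1 != 0 -> p2 != 0 -> q != 0 ->
  resultant (p1 * p2) q = resultant p1 q * resultant p2 q.
Proof.
move=> p1_0 p2_0 q0; rewrite !resultant_mulmod ?mulf_neq0 //.
rewrite mulmod_mxM ?prednK ?size_poly_gt0 // det_mulmx mulrACA -exprD.
congr (_ ^+ _ * _); rewrite size_mul // -(prednK (n := size p1)) ?size_poly_gt0 //.
by rewrite -(prednK (n := size p2)) ?size_poly_gt0 // addSn addnS.
Qed.

Lemma size_scale_prod_XsubC (F : fieldType) (a : F) (s : seq F) : a != 0 ->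
  size (a *: \prod_(x <- s) ('X - x%:P)) = (size s).+1.
Proof. by move=> a0; rewrite size_scale // size_prod_XsubC. Qed.

Lemma resultant_split (F : fieldType) (a b : F) (s t : seq F) :
  a != 0 -> b != 0 ->
  resultant (a *: \prod_(x <- s) ('X - x%:P)) (b *: \prod_(y <- t) ('X - y%:P)) =
  a ^+ size t * b ^+ size s * \prod_(x <- s) \prod_(y <- t) (y - x).
Proof.
move=> a0 b0; set p := a *: _; set q := b *: _.
have sp : size p = (size s).+1 by apply: size_scale_prod_XsubC.
have sq : size q = (size t).+1 by apply: size_scale_prod_XsubC.
have q1_sz : size (\prod_(y <- t) ('X - y%:P)) = (size t).+1.
  by rewrite size_prod_XsubC.
rewrite resultant_mulmod -?size_poly_eq0 ?sp ?sq //= lead_coefZ.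
rewrite (monicP (monic_prod_XsubC _ _ _)) mulr1 [a ^+ _ * _]mulrC -mulrA.
congr (_ * _); rewrite /q mulmod_mxZr // /p -mul_polyC mulmod_mxM //.
rewrite mulmod_mxC // det_mulmx det_scalar; congr (_ * _).
elim: s {p sp} => [|x s IH]; first by rewrite !big_nil mulmod_mxC // det1.
rewrite !big_cons mulmod_mxM // det_mulmx IH; congr (_ * _).
rewrite det_mulmod_XsubC ?monic_prod_XsubC //.
rewrite horner_prod; elim: t {q sq q1_sz IH} => [|y t IH].
  by rewrite !big_nil mulr1.
by rewrite !big_cons exprS mulrACA IH !hornerE mulN1r opprB.
Qed.

(** Used for the embeddings of the integers into Q and into C. *)
Lemma map_resultant_inj (aR rR : nzRingType) (f : {rmorphism aR -> rR})
    (p q : {poly aR}) : injective f ->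
  f (resultant p q) = resultant (map_poly f p) (map_poly f q).
Proof.
move=> f_inj; rewrite /resultant /Sylvester_mx !size_map_inj_poly ?rmorph0 //.
rewrite -det_map_mx /= map_col_mx; congr (\det (col_mx _ _));
  by apply: map_lin1_mx => v; rewrite map_poly_rV rmorphM /= map_rVpoly.
Qed.

Lemma resultant_int_Ml (p1 p2 q : {poly int}) : p1 != 0 -> p2 != 0 -> q != 0 ->
  resultant (p1 * p2) q = resultant p1 q * resultant p2 q.
Proof.
have inj : injective (intr : int -> rat) by apply: intr_inj.
move=> p1_0 p2_0 q0; apply: inj.
rewrite rmorphM /= !map_resultant_inj //; try exact: intr_inj.
by rewrite rmorphM resultantMl // map_poly_eq0_id0 // intr_eq0 lead_coef_eq0.
Qed.

Lemma resultant_int_prod (s : seq {poly int}) (q : {poly int}) :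
  q != 0 -> all (fun h => h != 0) s ->
  resultant (\prod_(h <- s) h) q = \prod_(h <- s) resultant h q.
Proof.
move=> q0; elim: s => [|h s IH] /=.
  rewrite !big_nil => _; apply: (@intr_inj rat).
  rewrite map_resultant_inj; last exact: intr_inj.
  rewrite rmorph1 resultant_mulmod ?oner_neq0 //; last first.
    by rewrite map_poly_eq0_id0 // intr_eq0 lead_coef_eq0.
  rewrite size_poly1 mul1r mulmod_mxC ?det1 // prednK // size_poly_gt0.
  by rewrite map_poly_eq0_id0 // intr_eq0 lead_coef_eq0.
case/andP=> h0 s0; rewrite !big_cons resultant_int_Ml ?IH //.
by rewrite prodf_seq_neq0; apply/allP => x /(allP s0).
Qed.

Lemma resultant_splitC (F : fieldType) (a b : F) (s t : seq F)
    (p := a *: \prod_(x <- s) ('X - x%:P))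
    (q := b *: \prod_(y <- t) ('X - y%:P)) : a != 0 -> b != 0 ->
  resultant q p = (-1) ^+ (size s * size t) * resultant p q.
Proof.
move=> a0 b0; rewrite /p /q !resultant_split // mulrCA; congr (_ * _).
  by rewrite mulrC.
rewrite exchange_big -signr_odd /=; set z := (- 1) ^+ _.
have -> : z = \prod_(x <- s) \prod_(y <- t) (-1).
  rewrite /z signr_odd (eq_bigr (fun=> (-1) ^+ size t)) => [|x _].
    by rewrite big_const_seq count_predT iter_mulr_1 -exprM mulnC.
  by rewrite big_const_seq count_predT iter_mulr_1.
rewrite -big_split /=; apply: eq_bigr => x _; rewrite -big_split /=.
by apply: eq_bigr => y _; rewrite mulN1r opprB.
Qed.

(** Over the complex numbers both polynomials split, and in the product formula
    the exchange only changes the sign of the differences of roots. *)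
Lemma absz_resultantC (p q : {poly int}) : p != 0 -> q != 0 ->
  `|resultant q p|%N = `|resultant p q|%N.
Proof.
move=> p0 q0; pose C := algC.
have inj : injective (intr : int -> C) := @intr_inj C.
have nz (r : {poly int}) : r != 0 -> lead_coef (map_poly intr r : {poly C}) != 0.
  by move=> r0; rewrite lead_coef_eq0 map_poly_eq0_id0 // intr_eq0 lead_coef_eq0.
have [s ps] := closed_field_poly_normal (map_poly intr p : {poly C}).
have [t qt] := closed_field_poly_normal (map_poly intr q : {poly C}).
apply/eqP; rewrite -eqz_nat !abszE -(inj_eq inj) !intr_norm.
rewrite !map_resultant_inj // ps qt.
by rewrite resultant_splitC ?nz // normrM normrX normrN1 expr1n mul1r.
Qed.

(** * Counting prime factors *)

(** [Omega] on natural numbers. *)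
Definition bigomega n := (\sum_(p <- primes n) logn p n)%N.

(** Summing the valuations of [m] over the primes of any multiple of [m] lets the
    sums for two factors be taken over the same primes as that for the product. *)
Lemma bigomega_dvd m n : (0 < n)%N -> (m %| n)%N ->
  bigomega m = (\sum_(p <- primes n) logn p m)%N.
Proof.
move=> n0 mn; rewrite [RHS](bigID (mem (primes m))) /= [X in (_ + X)%N]big1.
  rewrite addn0 -big_filter; apply: perm_big; apply: uniq_perm.
  - exact: primes_uniq.
  - by rewrite filter_uniq // primes_uniq.
  move=> p; rewrite mem_filter andb_idr // !mem_primes n0 => /and3P[-> _ pm].
  exact: dvdn_trans mn.
by move=> p; rewrite -logn_gt0 lt0n negbK => /eqP.
Qed.

Lemma bigomegaM m n : (0 < m)%N -> (0 < n)%N ->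
  bigomega (m * n) = (bigomega m + bigomega n)%N.
Proof.
move=> m0 n0; have mn0 : (0 < m * n)%N by rewrite muln_gt0 m0.
rewrite (bigomega_dvd m _ mn0) ?dvdn_mulr // (bigomega_dvd n _ mn0) ?dvdn_mull //.
by rewrite -big_split; apply: eq_bigr => p _; rewrite lognM.
Qed.

Lemma bigomega_gt0 n : (1 < n)%N -> (0 < bigomega n)%N.
Proof.
move=> n1; have pn : pdiv n \in primes n.
  by rewrite mem_primes pdiv_prime // pdiv_dvd ltnW.
by rewrite /bigomega (big_rem _ pn) /= ltn_addr // logn_gt0.
Qed.

(** By induction: the first factor [a] absorbs the part [c = gcdn d a] of [d].
    Since [c <= d < a], the cofactor [a %/ c] contributes a prime. As [d %/ c] is
    coprime to [a %/ c], it divides the product of the other factors, each of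
    which still exceeds it. *)
Lemma size_le_bigomega (d : nat) (s : seq nat) : (0 < d)%N ->
    all (ltn d) s -> (d %| \prod_(a <- s) a)%N ->
  (size s <= bigomega (\prod_(a <- s) a %/ d))%N.
Proof.
elim: s d => [//|a s IH] d d0 /= /andP[lt_da lt_ds]; rewrite big_cons.
set P := (\prod_(_ <- s) _)%N => d_dv.
have P0 : (0 < P)%N.
  rewrite /P big_seq_cond prodn_cond_gt0 // => x; rewrite andbT.
  by move/(allP lt_ds); apply: leq_ltn_trans.
have a0 : (0 < a)%N by apply: leq_ltn_trans lt_da.
pose c := gcdn d a; have c0 : (0 < c)%N by rewrite gcdn_gt0 d0.
have c_d : (c %| d)%N by apply: dvdn_gcdl.
have c_a : (c %| a)%N by apply: dvdn_gcdr.
have e0 : (0 < d %/ c)%N by rewrite divn_gt0 // dvdn_leq.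
have cop : coprime (d %/ c) (a %/ c).
  rewrite /coprime -(eqn_pmul2r c0) mul1n muln_gcdl !divnK //.
have e_P : (d %/ c %| P)%N.
  rewrite -(Gauss_dvdr _ cop) -(dvdn_pmul2r c0) divnK //.
  by rewrite mulnAC divnK.
have le_ed : (d %/ c <= d)%N by apply: leq_div.
have -> : (a * P %/ d = (a %/ c) * (P %/ (d %/ c)))%N.
  apply/eqP; rewrite eq_sym eqn_div //.
  rewrite -[X in (_ * X == _)%N](divnK c_d) [(_ %/ c * c)%N in X in (X == _)]mulnC.
  by rewrite mulnACA !divnK.
have a_c : (1 < a %/ c)%N.
  by rewrite ltn_divRL // mul1n (leq_ltn_trans (dvdn_leq d0 c_d)).
rewrite bigomegaM; last 2 first.
- exact: ltnW.
- by rewrite divn_gt0 // dvdn_leq.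
apply: (@leq_add 1%N); first exact: bigomega_gt0.
apply: IH => //; apply: sub_all lt_ds => x; exact: leq_ltn_trans.
Qed.

(** * Irreducible factors and resultants *)

(** A factor over Q of an integer polynomial is proportional to an integer
    polynomial that divides it over the integers, so splitting off proper
    factors over Q never leaves the integer polynomials. *)
Lemma exists_int_factorization (f : {poly int}) : (1 < size f)%N ->
  exists2 s : seq {poly int},
    forall h, h \in s -> irreducible_poly (polyZQ h) & f = \prod_(h <- s) h.
Proof.
have [n] := ubnP (size f); elim: n f => // n IH f /ltnSE le_fn f1.
have f0 : f != 0 by rewrite -size_poly_gt0 ltnW.
have szQ h : size (polyZQ h) = size h.
  by rewrite size_map_inj_poly // => x y /intr_inj.
have [irr|] := boolp.EM (irreducible_poly (polyZQ f)).
  by exists [:: f]; rewrite ?big_seq1 // => h; rewrite inE => /eqP->.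
move=> nirr; have [q [q1 q_f q_nf]] : exists q : {poly rat},
    [/\ size q != 1, q %| polyZQ f & ~~ (q %= polyZQ f)].
  apply: boolp.contrapT => no_q; apply: nirr; split; first by rewrite szQ.
  move=> q q1 q_f; apply/negPn/negP => q_nf; apply: no_q; by exists q.
have [p [a a0 def_q] [r def_f]] := dvdpP_rat_int q_f.
have [p0 r0] : p != 0 /\ r != 0.
  by apply/andP; rewrite -negb_or -mulf_eq0 -def_f.
have sz_q : size q = size p by rewrite def_q size_scale // szQ.
have p1 : (1 < size p)%N.
  by rewrite ltn_neqAle eq_sym -sz_q q1 sz_q size_poly_gt0.
have r1 : (1 < size r)%N.
  rewrite ltnNge; apply: contra q_nf => r1.
  rewrite -dvdp_size_eqp // szQ sz_q def_f size_mul //.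
  have -> : size r = 1 by apply/eqP; rewrite eqn_leq r1 size_poly_gt0.
  by rewrite addn1.
have sz_f : size f = (size p + size r).-1 by rewrite def_f size_mul.
have [s s_irr def_p] : exists2 s : seq {poly int},
    forall h, h \in s -> irreducible_poly (polyZQ h) & p = \prod_(h <- s) h.
  apply: IH => //; apply: leq_trans le_fn; rewrite sz_f.
  by rewrite -(prednK (ltnW r1)) addnS /= -[X in (X < _)%N]addn0 ltn_add2l -ltnS prednK // ltnW.
have [t t_irr def_r] : exists2 s : seq {poly int},
    forall h, h \in s -> irreducible_poly (polyZQ h) & r = \prod_(h <- s) h.
  apply: IH => //; apply: leq_trans le_fn; rewrite sz_f.
  by rewrite -(prednK (ltnW p1)) addSn /= -[X in (X < _)%N]add0n ltn_add2r -ltnS prednK // ltnW.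
exists (s ++ t); last by rewrite def_f def_p def_r big_cat.
by move=> h; rewrite mem_cat => /orP[/s_irr|/t_irr].
Qed.

(** The hypothesis ranges over all integer divisors [h] of [f] because the
    factorization into irreducibles is only chosen in the proof. *)
Lemma product_of_few_irreducibles (f g : {poly int}) (d : nat) :
    (1 < size f)%N -> g != 0 -> (0 < d)%N -> (d %| `|resultant f g|)%N ->
    (forall h r, f = h * r -> (1 < size h)%N -> (d < `|resultant h g|)%N) ->
  product_of_at_most_irreducibles (bigomega (`|resultant f g| %/ d)) (polyZQ f).
Proof.
move=> f1 g0 d0 d_dv lt_d; have [s s_irr def_f] := exists_int_factorization _ f1.
have s1 h : h \in s -> (1 < size h)%N.
  move=> /s_irr[]; rewrite size_map_inj_poly // => x y; exact: intr_inj.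
exists (map polyZQ s); split.
- by move=> q /mapP[h /s_irr irr ->].
- by rewrite big_map def_f /polyZQ rmorph_prod.
have def_res : `|resultant f g|%N = (\prod_(a <- [seq `|resultant h g|%N | h <- s]) a)%N.
  rewrite def_f resultant_int_prod //; last first.
    by apply/allP => h /s1; rewrite -size_poly_gt0; apply: leq_trans.
  by rewrite big_map (big_morph absz abszM absz1).
rewrite size_map -(size_map (fun h => `|resultant h g|%N)).
rewrite def_res size_le_bigomega // -?def_res //.
apply/allP => _ /mapP[h hs ->]; apply: (lt_d h (\prod_(k <- rem h s) k)) (s1 _ hs).
by rewrite def_f (big_rem _ hs).
Qed.

(** * Lower bound for the resultant of polynomials with distant roots *)

Lemma ltr_prod_seq (K : numDomainType) (I : eqType) (s : seq I) (e : K)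
    (w : I -> K) : 0 <= e -> (0 < size s)%N ->
  (forall x, x \in s -> e < w x) -> e ^+ size s < \prod_(x <- s) w x.
Proof.
move=> e0; case: s => // x s _; elim: s x => [|y s IH] x ltw.
  by rewrite big_seq1 expr1 ltw ?mem_head.
rewrite big_cons exprS ltr_pM ?exprn_ge0 ?ltw ?mem_head //.
by apply: IH => z zs; rewrite ltw // inE zs orbT.
Qed.

Lemma prod_root_sub_inv (F : fieldType) (s t : seq F) :
    (forall x, x \in s -> x != 0) -> (forall y, y \in t -> y != 0) ->
  \prod_(x <- s) \prod_(y <- t) (y - x) =
  (\prod_(x <- s) x) ^+ size t * (\prod_(y <- t) y) ^+ size s *
  \prod_(x <- s) \prod_(y <- t) (x^-1 - y^-1).
Proof.
move=> s0 t0.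
have -> : (\prod_(x <- s) x) ^+ size t = \prod_(x <- s) \prod_(y <- t) x.
  rewrite -prodrXl; apply: eq_bigr => x _.
  by rewrite big_const_seq count_predT iter_mulr_1.
have -> : (\prod_(y <- t) y) ^+ size s = \prod_(x <- s) \prod_(y <- t) y.
  by rewrite big_const_seq count_predT iter_mulr_1.
rewrite -!big_split /= big_seq [RHS]big_seq; apply: eq_bigr => x /s0 x0.
rewrite -!big_split /= big_seq [RHS]big_seq; apply: eq_bigr => y /t0 y0.
by rewrite mulrBr mulfK // [x * y]mulrC mulfK.
Qed.

Lemma norm_intr_ge1 (K : numDomainType) (z : int) : z != 0 -> 1 <= `|z%:~R : K|.
Proof. by move=> z0; rewrite -intr_norm -[1]/(1%:~R) ler_int -gtz0_ge1 normr_gt0. Qed.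

(** In both cases |Res(f, g)| is the product of a number [A >= 1] and of the
    distances [w x y > e]: [A] comes from the leading coefficients in the first
    case and from the constant terms in the second, which are nonzero integers.
    The exponent [k] allows [e] to be a root of the integer to be exceeded. *)
Lemma lt_norm_resultant (C : numClosedFieldType) (f g : {poly int}) (e : C)
    (k : nat) (fC := map_poly intr f : {poly C}) (gC := map_poly intr g : {poly C}) :
    1 <= e -> (1 < size f)%N -> (1 < size g)%N ->
    (k <= (size f).-1 * (size g).-1)%N ->
    (forall x y, root fC x -> root gC y -> e < `|x - y|) \/
    (forall x y, root fC x -> root gC y ->
       [/\ x != 0, y != 0 & e < `|x^-1 - y^-1|]) ->
  e ^+ k < `|resultant f g|%:~R.
Proof.
move=> e1 f1 g1 le_k far; have e0 : 0 <= e by apply: le_trans e1.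
have f0 : f != 0 by rewrite -size_poly_gt0 ltnW.
have g0 : g != 0 by rewrite -size_poly_gt0 ltnW.
have inj : injective (intr : int -> C) := @intr_inj C.
have lead (h : {poly int}) : lead_coef (map_poly intr h : {poly C}) = (lead_coef h)%:~R.
  by rewrite lead_coef_map_inj.
have [s fs] := closed_field_poly_normal fC.
have [t gt] := closed_field_poly_normal gC.
have a0 : lead_coef fC != 0 by rewrite lead intr_eq0 lead_coef_eq0.
have b0 : lead_coef gC != 0 by rewrite lead intr_eq0 lead_coef_eq0.
have sz_s : (size s) = (size f).-1.
  by rewrite -(size_map_inj_poly inj) // -/fC fs size_scale_prod_XsubC.
have sz_t : (size t) = (size g).-1.
  by rewrite -(size_map_inj_poly inj) // -/gC gt size_scale_prod_XsubC.
have root_s x : x \in s -> root fC x.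
  by rewrite fs rootZ // root_prod_XsubC.
have root_t y : y \in t -> root gC y.
  by rewrite gt rootZ // root_prod_XsubC.
have s_gt0 : (0 < size s)%N by rewrite sz_s -ltnS prednK // ltnW.
have t_gt0 : (0 < size t)%N by rewrite sz_t -ltnS prednK // ltnW.
have [A [w A1 [lt_w ->]]] : exists A : C, exists2 w : C -> C -> C, 1 <= A &
    (forall x y, x \in s -> y \in t -> e < w x y) /\
    `|resultant f g|%:~R = A * \prod_(x <- s) \prod_(y <- t) w x y.
  have norm_prod (w : C -> C -> C) : `|\prod_(x <- s) \prod_(y <- t) w x y| =
      \prod_(x <- s) \prod_(y <- t) `|w x y|.
    by rewrite normr_prod; apply: eq_bigr => x _; rewrite normr_prod.
  rewrite intr_norm map_resultant_inj // -/fC -/gC.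
  case: far => far.
    exists (`|lead_coef fC ^+ size t * lead_coef gC ^+ size s|).
    exists (fun x y => `|y - x|).
      by rewrite normrM !normrX !lead mulr_ege1 ?exprn_ege1 ?norm_intr_ge1 ?lead_coef_eq0.
    split=> [x y /root_s rx /root_t ry|]; first by rewrite distrC far.
    by rewrite {1}fs {1}gt resultant_split // normrM norm_prod.
  have s0 x : x \in s -> x != 0.
    case: t t_gt0 root_t {gt sz_t norm_prod} => // y t _ root_t /root_s rx.
    by have [] := far x y rx (root_t y (mem_head _ _)).
  have t0 y : y \in t -> y != 0.
    case: s s_gt0 root_s {fs sz_s norm_prod s0} => // x s _ root_s /root_t ry.
    by have [] := far x y (root_s x (mem_head _ _)) ry.
  (* The number below is, up to sign, the constant coefficient of [h]. *)
  have const_ge1 (h : {poly int}) (c : C) (r : seq C) :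
      c != 0 -> (forall x, x \in r -> x != 0) ->
      map_poly intr h = c *: \prod_(x <- r) ('X - x%:P) ->
      1 <= `|c * \prod_(x <- r) x|.
    move=> c0 r0 hr.
    have -> : `|c * \prod_(x <- r) x| = `|(h`_0)%:~R : C|.
      rewrite -coef_map /= hr -horner_coef0 hornerZ horner_prod !normrM !normr_prod.
      by congr (_ * _); apply: eq_bigr => x _; rewrite hornerXsubC sub0r normrN.
    apply: norm_intr_ge1; rewrite -(inj_eq inj) -coef_map /= hr -horner_coef0.
    rewrite hornerZ horner_prod mulf_neq0 // prodf_seq_neq0; apply/allP => x /r0.
    by rewrite hornerXsubC sub0r oppr_eq0.
  exists (`|lead_coef fC * \prod_(x <- s) x| ^+ size t *
          `|lead_coef gC * \prod_(y <- t) y| ^+ size s).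
  exists (fun x y => `|x^-1 - y^-1|).
    apply: mulr_ege1; apply: exprn_ege1.
      exact: const_ge1 a0 s0 fs.
    exact: const_ge1 b0 t0 gt.
  split=> [x y /root_s rx /root_t ry|]; first by have [] := far x y rx ry.
  rewrite {1}fs {1}gt resultant_split // prod_root_sub_inv // -norm_prod.
  by rewrite -!normrX -!normrM !exprMn mulrA; congr `|_ * _|; rewrite mulrACA.
have lt_prod : e ^+ (size s * size t) < \prod_(x <- s) \prod_(y <- t) w x y.
  rewrite mulnC exprM; apply: ltr_prod_seq => //; first exact: exprn_ge0.
  by move=> x xs; apply: ltr_prod_seq => // y yt; apply: lt_w.
apply: (@le_lt_trans _ _ (e ^+ (size s * size t))).
  by rewrite ler_weXn2l // sz_s sz_t.
apply: lt_le_trans (lt_prod) _; rewrite ler_peMl //.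
exact: ltW (le_lt_trans (exprn_ge0 _ e0) lt_prod).
Qed.

Lemma lt_min_dist (R : realType) (s t : seq R[i]) (e : R) (x y : R[i]) :
  (e%:E < min_dist s t)%E -> x \in s -> y \in t ->
  (real_complex R e) < `|x - y|.
Proof.
move=> lt_e xs yt; have : (e%:E < (ComplexField.Normc.normc (x - y))%:E)%E.
  apply: lt_le_trans lt_e _; apply: (bigmin_inf_seq _ _ _ _ _ xs) => //.
  exact: (bigmin_inf_seq _ _ _ _ _ yt).
rewrite lte_fin => lt_xy.
rewrite -[`|_|]/((ComplexField.Normc.normc (x - y))%:C)%C.
by rewrite ltcR.
Qed.

Theorem theorem2p2 (R : realType) (f g : {poly int}) (n m : nat)
    (theta : n.-tuple R[i]) (xi : m.-tuple R[i]) (d : int)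
    (hn : n = deg f) (hm : m = deg g)
    (hn0 : (0 < n)%N) (hm0 : (0 < m)%N)
    (hfg : coprimep (polyZQ f) (polyZQ g))
    (htheta : complex_roots f theta) (hxi : complex_roots g xi)
    (hne0 : (\prod_(x <- theta) x) * (\prod_(y <- xi) y) != 0)
    (hd0 : 0 < d) (hd : (d %| resultant f g)%Z)
    (hmin :
      (((d%:~R : R) `^ (minn m n)%:R^-1)%R%:E < min_dist theta xi)%E \/
      (((d%:~R : R) `^ (minn m n)%:R^-1)%R%:E <
         min_dist [seq (x^-1)%R | x <- theta] [seq (y^-1)%R | y <- xi])%E) :
  product_of_at_most_irreducibles (Omega (resultant f g %/ d)%Z) (polyZQ f) /\
  product_of_at_most_irreducibles (Omega (resultant f g %/ d)%Z) (polyZQ g).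
Proof.
have sz_f : size f = n.+1 by move: hn0; rewrite hn /deg; case: (size f).
have sz_g : size g = m.+1 by move: hm0; rewrite hm /deg; case: (size g).
have f0 : f != 0 by rewrite -size_poly_eq0 sz_f.
have g0 : g != 0 by rewrite -size_poly_eq0 sz_g.
case: d hd0 hd hmin => // d d0 hd hmin.
have -> : Omega (resultant f g %/ d)%Z = bigomega (`|resultant f g| %/ d).
  have /dvdzP[c ->] := hd.
  rewrite /Omega -/(bigomega _) mulzK ?gt_eqF // abszM absz_nat mulnK //.
set e : R := _ `^ _ in hmin.
have d1 : 1 <= (d%:~R : R) by rewrite -[1]/(1%:~R) ler_int.
have e1 : 1 <= e.
  by rewrite -(powRr0 (d%:~R : R)) ler_powR // invr_ge0 ler0n.
have e_pow : e ^+ minn m n = d%:~R.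
  rewrite -powR_mulrn ?powR_ge0 // -powRrM mulVf ?powRr1 //.
  by rewrite pnatr_eq0 -lt0n leq_min hm0.
have rootE h (s : seq R[i]) r : complex_roots h s -> h != 0 ->
    root (map_poly intr h : {poly R[i]}) r = (r \in s).
  by move=> -> h0; rewrite rootZ ?root_prod_XsubC // intr_eq0 lead_coef_eq0.
have /andP[theta0 xi0] : (\prod_(x <- theta) x != 0) && (\prod_(y <- xi) y != 0).
  by rewrite -negb_or -mulf_eq0.
have far :
    (forall x y, x \in tval theta -> y \in tval xi -> real_complex R e < `|x - y|) \/
    (forall x y, x \in tval theta -> y \in tval xi ->
       [/\ x != 0, y != 0 & real_complex R e < `|x^-1 - y^-1|]).
  case: hmin => lt_e; [left|right] => x y xs yt; first exact: lt_min_dist lt_e xs yt.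
  split.
  - by move: theta0; rewrite prodf_seq_neq0 => /allP/(_ _ xs).
  - by move: xi0; rewrite prodf_seq_neq0 => /allP/(_ _ yt).
  by apply: lt_min_dist lt_e _ _; apply: map_f.
(* Stated for roots in either order, to serve both for divisors of f against g
   and for divisors of g against f. *)
have lt_d (h1 h2 : {poly int}) : (1 < size h1)%N -> (1 < size h2)%N ->
    (minn m n <= (size h1).-1 * (size h2).-1)%N ->
    (forall x y, root (map_poly intr h1 : {poly R[i]}) x ->
                 root (map_poly intr h2 : {poly R[i]}) y ->
                 (x \in tval theta) && (y \in tval xi) \/
                 (y \in tval theta) && (x \in tval xi)) ->
    (d < `|resultant h1 h2|)%N.
  move=> h1_1 h2_1 le_k sub.
  have := @lt_norm_resultant _ h1 h2 (real_complex R e) _ _ h1_1 h2_1 le_k.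
  rewrite -rmorphXn /= e_pow => lt_res.
  have : (real_complex R d%:~R) < `|resultant h1 h2|%:~R.
    apply: lt_res; first by rewrite -[1]/(real_complex R 1) lecR.
    case: far => far; [left|right] => x y rx ry.
      have [/andP[]|/andP[]] := sub x y rx ry => xs ys; first exact: far.
      by rewrite distrC; apply: far.
    have [/andP[]|/andP[]] := sub x y rx ry => xs ys.
      exact: far.
    by have [y0 x0 lt] := far _ _ xs ys; split=> //; rewrite distrC.
  by rewrite rmorph_int ltr_int -abszE.
have root_mul (h r : {poly int}) x : root (map_poly intr h : {poly R[i]}) x ->
    root (map_poly intr (h * r) : {poly R[i]}) x.
  by rewrite rmorphM rootM => ->.
split.
  apply: product_of_few_irreducibles => //; rewrite ?sz_f //.
  move=> h r def_f h1; apply: lt_d => //; rewrite ?sz_g //=.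
    rewrite (leq_trans (geq_minl _ _)) // leq_pmull // -ltnS prednK // ltnW //.
  move=> x y rx; rewrite (rootE _ _ _ hxi) // => ->; left.
  by rewrite -(rootE _ _ _ htheta) // def_f root_mul.
rewrite -absz_resultantC //; apply: product_of_few_irreducibles => //; rewrite ?sz_g //.
  by rewrite absz_resultantC.
move=> h r def_g h1; apply: lt_d => //; rewrite ?sz_f //=.
  rewrite (leq_trans (geq_minr _ _)) // leq_pmull // -ltnS prednK // ltnW //.
move=> x y rx; rewrite (rootE _ _ _ htheta) // => ->; right.
by rewrite -(rootE _ _ _ hxi) // def_g root_mul.
Qed.
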